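(* Let $R,S$ be Dedekind domains and let $h:G(R)\longrightarrow G(S)$ be a homeomorphism. Then the following hold. (a) If $h(1)=1$, then $h(\mathcal{F}_x)=\mathcal{F}_{h(x)}$ for every $x\in R^\bullet$. (b) $h$ induces an order isomorphism $$\overline{h}\colon \mathcal{V}(R)\longrightarrow\mathcal{V}(S),\qquad V(x)\longmapsto V(h(x)),$$ where $\mathcal{V}(R)$ and $\mathcal{V}(S)$ are ordered by containment (in particular, this map is well-defined).
   Context: A Dedekind domain is a one-dimensional Noetherian integrally closed domain. For an integral domain $R$, set $R^\bullet:=R\setminus\{0\}$. The Golomb space $G(R)$ is the set $R^\bullet$ endowed with the topology generated by the cosets $a+I$, where $a\in R$ and $I$ is a nonzero ideal of $R$ such that $\langle a,I\rangle=R$. For $X\subseteq R^\bullet$, $\overline{X}$ denotes the closure of $X$ in $G(R)$. For $x\in R^\bullet$, $\mathcal{F}_x$ is the set of all $F\subseteq R^\bullet$ such that there are a neighborhood $U_x$ of $x$ and a neighborhood $U_1$ of $1$ in $G(R)$ with $\overline{U_x}\cap\overline{U_1}\subseteq F$ (and similarly for $S$); $h(\mathcal{F}_x):=\{h(F)\mid F\in\mathcal{F}_x\}$. For $x\in R^\bullet$, $V(x):=\{M\in\mathrm{Max}(R)\mid x\in M\}$, where $\mathrm{Max}(R)$ is the set of maximal ideals of $R$, and $\mathcal{V}(R):=\{V(x)\mid x\in R^\bullet\}$. *)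

(* Defs.v *)
From HB Require Import structures.
From mathcomp Require Import all_boot all_order all_algebra.
From mathcomp Require Import all_classical topology.

Set Implicit Arguments.
Unset Strict Implicit.
Unset Printing Implicit Defensive.

Import GRing.Theory.

Local Open Scope classical_set_scope.
Local Open Scope ring_scope.

(* Ideals are classical sets and may be improper; the predicates of
   ring_quotient are boolean and exclude the unit ideal. *)
Definition is_ideal (R : idomainType) (I : set R) : Prop :=
  [/\ I 0,
      forall x y : R, I x -> I y -> I (x + y) &
      forall a x : R, I x -> I (a * x)].

Definition is_prime_ideal (R : idomainType) (P : set R) : Prop :=
  [/\ is_ideal P, P <> setT & forall x y : R, P (x * y) -> P x \/ P y].

Definition is_maximal_ideal (R : idomainType) (M : set R) : Prop :=
  [/\ is_ideal M, M <> setT &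
      forall J : set R, is_ideal J -> M `<=` J -> J = M \/ J = setT].

Definition ideal_span (R : idomainType) (A : set R) : set R :=
  smallest (@is_ideal R) A.

Definition noetherian (R : idomainType) : Prop :=
  forall I : set R, is_ideal I -> exists s : seq R, I = ideal_span [set` s].

(* A strictly increasing chain P_0, ..., P_n has length n. *)
Definition has_prime_chain (R : idomainType) (n : nat) : Prop :=
  exists P : 'I_n.+1 -> set R,
    (forall i, is_prime_ideal (P i)) /\
    (forall i j : 'I_n.+1, (i < j)%N -> P i `<` P j).

Definition krull_dimension (R : idomainType) (n : nat) : Prop :=
  has_prime_chain R n /\
  (forall m : nat, has_prime_chain R m -> (m <= n)%N).

Definition integrally_closed (R : idomainType) : Prop :=
  forall x : {fraction R},
    integralOver (@tofrac R) x -> exists a : R, x = tofrac a.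

Definition dedekind_domain (R : idomainType) : Prop :=
  [/\ krull_dimension R 1, noetherian R & integrally_closed R].

Definition golomb (R : idomainType) : Type := {x : R | x != 0}.

HB.instance Definition _ (R : idomainType) := Choice.on (golomb R).

(* The trace of a + I on the nonzero elements: a + I itself avoids 0 except
   when I is the unit ideal, where the trace is the whole space. *)
Definition golomb_coset (R : idomainType) (a : R) (I : set R) :
    set (golomb R) :=
  [set u : golomb R | exists2 i, I i & val u = a + i].

Definition golomb_subbase (R : idomainType) : set (set (golomb R)) :=
  [set U | exists (a : R) (I : set R),
     [/\ is_ideal I, I <> [set 0], ideal_span (a |` I) = setT &
         U = golomb_coset a I]].

HB.instance Definition _ (R : idomainType) :=
  isSubBaseTopological.Build (golomb R) (@golomb_subbase R) id.

Definition golomb1 (R : idomainType) : golomb R :=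
  exist _ 1 (oner_neq0 R).

Definition homeomorphism (T U : topologicalType) (f : T -> U) : Prop :=
  exists g : U -> T,
    [/\ cancel f g, cancel g f, continuous f & continuous g].

Definition golomb_filter (R : idomainType) (x : golomb R) :
    set (set (golomb R)) :=
  [set F | exists Ux U1 : set (golomb R),
     [/\ nbhs x Ux, nbhs (golomb1 R) U1 & closure Ux `&` closure U1 `<=` F]].

Definition maxV (R : idomainType) (x : golomb R) : set (set R) :=
  [set M | is_maximal_ideal M /\ M (val x)].

Definition calV (R : idomainType) : set (set (set R)) := range (@maxV R).
Arguments calV R : clear implicits.

(* phi is an isomorphism between A and B ordered by inclusion; its values
   outside A are irrelevant. *)
Definition inclusion_isomorphism (T U : Type) (A : set (set T))
    (B : set (set U)) (phi : set T -> set U) : Prop :=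
  set_bij A B phi /\
  (forall X Y : set T, A X -> A Y -> (X `<=` Y <-> phi X `<=` phi Y)).

(* Main.v *)
Require Import Defs.
From mathcomp Require Import all_boot all_order all_algebra.
From mathcomp Require Import all_classical topology.
From mathcomp Require Import finmap ring.

(** Closures in a Golomb space can be read off one maximal ideal at a time. A
    point u lies in the closure of a + I exactly when u - a belongs to I + J for
    every nonzero ideal J comaximal with u. As J ranges over these ideals, nothing
    is asked at a maximal ideal containing u, while at any other maximal ideal u
    must be congruent to a modulo I. Hence, if y and z are distinct and both lie
    outside a maximal ideal M, sufficiently small cosets y + L and z + L have no
    point outside M common to their closures: such a point would be congruent at M
    both to y and to z, to a precision that separates them.

    This yields a description of the inclusion of V(y) in V(x) that mentions only
    open sets and closures, the relation [dominates x y]: for every z other than x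
    and y there is a point w other than x such that the closure of each
    neighborhood of x contains an intersection of closures of neighborhoods of y, z
    and w. If V(y) is contained in V(x), choose w so that V(z) and V(w) meet only
    inside V(x) ([exists_coprime_modulo]). A coset x + I only has conditions at the maximal
    ideals M containing I; these contain neither x nor y, hence miss z or w, and
    the pair y, z or the pair y, w forces every common point of the closures into M
    ([dominates_of_maxV_sub]). If on the contrary M contains y but not x, take
    z = y^2. Neither y nor z imposes a condition at M, so that at most w is felt
    there, and w differs from x: a point close to w at M (or of arbitrary class, if M
    contains w) and contained in all other relevant maximal ideals lies in the three
    closures, but not in the closure of a small coset at x ([maxV_sub_of_dominates]).

    Homeomorphisms preserve [dominates], so inclusions between the sets V(x), and
    with them equalities, are preserved and reflected; this is part (b), obtained
    without knowing the image of 1. Part (a) is transport of structure.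

    Localization at M is carried out inside the ring, by the ideals [local_ideal]
    of elements that fall into a principal ideal after multiplication by some s
    comaximal with a given ideal. Dimension one enters through [exp_split]:
    modulo n the ring splits into a factor where a given a is nilpotent and one
    where it is invertible, in the sense that some a^k (1 - t a) vanishes. *)

Set Implicit Arguments.
Unset Strict Implicit.
Unset Printing Implicit Defensive.

Import GRing.Theory.

Local Open Scope classical_set_scope.
Local Open Scope ring_scope.

(** * Ideals, comaximality and prime ideals *)

Lemma ideal_opp (R : idomainType) (I : set R) x : is_ideal I -> I x -> I (- x).
Proof. by case=> _ _ IM Ix; rewrite -mulN1r; apply: IM. Qed.

Lemma ideal_sub (R : idomainType) (I : set R) x y :
  is_ideal I -> I x -> I y -> I (x - y).
Proof.
by move=> iI Ix Iy; case: (iI) => _ ID _; apply: ID => //; exact: ideal_opp.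
Qed.

Lemma ideal_full (R : idomainType) (I : set R) : is_ideal I -> I 1 -> I = setT.
Proof.
by case=> _ _ IM I1; apply/seteqP; split=> // x _; rewrite -(mulr1 x); exact: IM.
Qed.

Lemma ideal_setI (R : idomainType) (I J : set R) :
  is_ideal I -> is_ideal J -> is_ideal (I `&` J).
Proof.
move=> [I0 ID IM] [J0 JD JM]; split=> //.
- by move=> x y [? ?] [? ?]; split; [apply: ID | apply: JD].
- by move=> a x [? ?]; split; [apply: IM | apply: JM].
Qed.

Definition ideal_adjoin (R : idomainType) (I : set R) (a : R) : set R :=
  [set y | exists b, I (y - b * a)].

Lemma ideal_adjoin_ideal (R : idomainType) (I : set R) a :
  is_ideal I -> is_ideal (ideal_adjoin I a).
Proof.
case=> I0 ID IM; split.
- by exists 0; rewrite mul0r subr0.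
- move=> x y [b xb] [c yc]; exists (b + c).
  by have := ID _ _ xb yc; congr (I _); ring.
- move=> c x [b xb]; exists (c * b).
  by have := IM c _ xb; congr (I _); ring.
Qed.

Lemma sub_ideal_adjoin (R : idomainType) (I : set R) a : I `<=` ideal_adjoin I a.
Proof. by move=> x Ix; exists 0; rewrite mul0r subr0. Qed.

Lemma mem_ideal_adjoin (R : idomainType) (I : set R) a :
  is_ideal I -> ideal_adjoin I a a.
Proof. by case=> I0 _ _; exists 1; rewrite mul1r subrr. Qed.

Definition nonzero (R : idomainType) (I : set R) : Prop :=
  exists2 c, I c & c != 0.

Lemma nonzeroP (R : idomainType) (I : set R) :
  is_ideal I -> (I <> [set 0] <-> nonzero I).
Proof.
case=> I0 _ _; split=> [nI | [c Ic c0] eI]; last first.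
  by move: Ic c0; rewrite eI => ->; rewrite eqxx.
apply: contrapT => nz; apply: nI; apply/seteqP; split=> [x Ix | _ -> //].
by apply: contrapT => /eqP x0; apply: nz; exists x.
Qed.

Lemma nonzero_setI (R : idomainType) (I J : set R) : is_ideal I -> is_ideal J ->
  nonzero I -> nonzero J -> nonzero (I `&` J).
Proof.
move=> [_ _ IM] [_ _ JM] [c Ic c0] [d Jd d0]; exists (c * d).
  by split; [rewrite mulrC; apply: IM | apply: JM].
by rewrite mulf_neq0.
Qed.

Definition comaximal (R : idomainType) (a : R) (I : set R) : Prop :=
  exists r, I (1 - r * a).

Lemma ideal_span_comaximal (R : idomainType) (a : R) (I : set R) :
  is_ideal I -> (ideal_span (a |` I) = setT <-> comaximal a I).
Proof.
move=> iI; split=> [sT | [r Ir]].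
  have : ideal_span (a |` I) 1 by rewrite sT.
  move=> /(_ (ideal_adjoin I a)) H.
  suff [r Hr] : ideal_adjoin I a 1 by exists r.
  apply: H; split; first exact: ideal_adjoin_ideal.
  by move=> x [-> | Ix]; [exact: mem_ideal_adjoin | exact: sub_ideal_adjoin].
apply/seteqP; split=> // x _ J [iJ aIJ].
rewrite (ideal_full iJ) //; case: iJ => _ JD JM.
have -> : 1 = (1 - r * a) + r * a by rewrite subrK.
by apply: JD; [apply: aIJ; right | apply: JM; apply: aIJ; left].
Qed.

Lemma comaximalS (R : idomainType) (a : R) (I J : set R) :
  I `<=` J -> comaximal a I -> comaximal a J.
Proof. by move=> IJ [r Ir]; exists r; apply: IJ. Qed.

Lemma comaximalM (R : idomainType) (a b : R) (I : set R) : is_ideal I ->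
  comaximal a I -> comaximal b I -> comaximal (a * b) I.
Proof.
move=> [_ ID IM] [r Ir] [q Iq]; exists (r * q).
by have := ID _ _ Ir (IM (r * a) _ Iq); congr (I _); ring.
Qed.

Lemma comaximal_setI (R : idomainType) (a : R) (I J : set R) :
  is_ideal I -> is_ideal J -> comaximal a I -> comaximal a J ->
  comaximal a (I `&` J).
Proof.
move=> [_ _ IM] [_ _ JM] [r Ir] [q Jq]; exists (r + q - r * q * a).
split; [have := IM (1 - q * a) _ Ir | have := JM (1 - r * a) _ Jq].
  by congr (I _); ring.
by congr (J _); ring.
Qed.

Lemma comaximal_translate (R : idomainType) (a i : R) (I : set R) : is_ideal I ->
  I i -> comaximal a I -> comaximal (a + i) I.
Proof.
move=> iI Ii [r Ir]; exists r; case: (iI) => _ _ IM.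
by have := ideal_sub iI Ir (IM r _ Ii); congr (I _); ring.
Qed.

Lemma exp_one_sub (R : idomainType) (a r : R) (k : nat) :
  exists q, (1 - r * a) ^+ k = 1 - q * a.
Proof.
elim: k => [|k [q IH]]; first by exists 0; rewrite mul0r subr0 expr0.
by exists (r + q - r * q * a); rewrite exprS IH; ring.
Qed.

(** An ideal maximal among those that avoid a multiplicative set is prime; Zorn's
    lemma supplies one above any given ideal. *)
Lemma prime_avoiding (R : idomainType) (T N : set R) :
  T 1 -> (forall x y, T x -> T y -> T (x * y)) ->
  is_ideal N -> (forall x, N x -> ~ T x) ->
  exists P, [/\ is_prime_ideal P, N `<=` P, forall x, P x -> ~ T x &
    forall J, is_ideal J -> P `<=` J -> (forall x, J x -> ~ T x) -> J = P].
Proof.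
move=> T1 TM iN NT.
(* The union with N makes the empty set, the union of the empty chain, eligible. *)
pose good (A : set R) := is_ideal (A `|` N) /\ forall x, (A `|` N) x -> ~ T x.
have [F FG Ftot|A [[iA AT] Amax]] := @Zorn_bigcup R good.
  case: (iN) => N0 ND NM; split; last first.
    move=> x [[X FX Xx] | Nx]; last exact: NT.
    by have [_ H] := FG _ FX; apply: H; left.
  split; first by right.
  - have step X x y : F X -> X x -> (X `|` N) y ->
        (\bigcup_(Y in F) Y `|` N) (x + y).
      move=> FX Xx Xy; have [[_ XD _] _] := FG _ FX.
      have [|Nxy] := XD x y (or_introl Xx) Xy; last by right.
      by left; exists X.
    move=> x y [[X FX Xx] | Nx] [[Y FY Yy] | Ny].
    + have [XY | YX] := Ftot _ _ FX FY.
        by apply: (step Y) => //; [exact: XY | left].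
      by apply: (step X) => //; left; exact: YX.
    + by apply: (step X) => //; right.
    + by rewrite addrC; apply: (step Y) => //; right.
    + by right; apply: ND.
  - move=> a x [[X FX Xx] | Nx]; last by right; apply: NM.
    have [[_ _ XM] _] := FG _ FX.
    have [|Nax] := XM a x (or_introl Xx); last by right.
    by left; exists X.
have Pmax J : is_ideal J -> A `|` N `<=` J -> (forall x, J x -> ~ T x) ->
    J = A `|` N.
  move=> iJ AJ JT; apply/seteqP; split=> //.
  apply: contrapT => nJ; apply: (Amax J).
    split; first by move=> x Ax; apply: AJ; left.
    by move=> JA; apply: nJ => x Jx; left; apply: JA.
  have -> : good J = (is_ideal J /\ forall x, J x -> ~ T x); last by [].
  by rewrite /good (_ : J `|` N = J) //; apply/setUidPl => x Nx; apply: AJ; right.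
exists (A `|` N); split=> //.
have grow x : ~ (A `|` N) x -> exists2 t, T t & ideal_adjoin (A `|` N) x t.
  move=> nx; apply: contrapT => nT; apply: nx.
  rewrite -(Pmax (ideal_adjoin (A `|` N) x)); first exact: mem_ideal_adjoin.
  - exact: ideal_adjoin_ideal.
  - exact: sub_ideal_adjoin.
  - by move=> t Ht Tt; apply: nT; exists t.
split=> //; first by move=> eT; apply: (AT 1) => //; rewrite eT.
move=> x y Pxy; apply: contrapT => /not_orP [/grow [t Tt [b tb]] /grow [s Ts [c sc]]].
apply: (AT _ _ (TM _ _ Tt Ts)).
case: iA => _ PD PM; set P := A `|` N in Pxy tb sc PD PM *.
have := PD _ _ (PM s _ tb) (PD _ _ (PM (b * x) _ sc) (PM (b * c) _ Pxy)).
by congr (P _); ring.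
Qed.

Lemma maximal_above (R : idomainType) (N : set R) : is_ideal N -> N <> setT ->
  exists2 M, is_maximal_ideal M & N `<=` M.
Proof.
move=> iN NT; have [||x Nx x1|P [pP NP P1 Pm]] := @prime_avoiding R [set 1] N _ _ iN.
- by [].
- by move=> x y -> ->; rewrite mulr1.
- by apply: NT; apply: ideal_full => //; rewrite -x1.
exists P => //; case: pP => iP nP _; split=> // J iJ PJ.
have [J1|J1] := pselect (J 1); first by right; exact: ideal_full.
by left; apply: Pm => // x Jx x1; apply: J1; rewrite -x1.
Qed.

Lemma maximal_not1 (R : idomainType) (M : set R) : is_maximal_ideal M -> ~ M 1.
Proof. by case=> iM nM _ M1; apply: nM; exact: ideal_full. Qed.

Lemma maximal_comaximal (R : idomainType) (M : set R) a :
  is_maximal_ideal M -> (comaximal a M <-> ~ M a).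
Proof.
move=> mM; case: (mM) => iM nM Mm; split=> [[r Mr] Ma | nMa].
  apply: (maximal_not1 mM); case: iM => _ MD MM.
  by have := MD _ _ Mr (MM r _ Ma); congr (M _); ring.
have [eM|eT] := Mm _ (ideal_adjoin_ideal a iM) (@sub_ideal_adjoin _ M a).
  by case: nMa; rewrite -eM; exact: mem_ideal_adjoin.
by have : ideal_adjoin M a 1 by rewrite eT.
Qed.

Lemma maximal_prime (R : idomainType) (M : set R) :
  is_maximal_ideal M -> is_prime_ideal M.
Proof.
move=> mM; case: (mM) => iM nM Mm; split=> // x y Mxy.
apply: contrapT => /not_orP[/(maximal_comaximal _ mM) cx /(maximal_comaximal _ mM) cy].
by have /(maximal_comaximal _ mM) := comaximalM iM cx cy; apply.
Qed.

Lemma comaximal_of_maximal (R : idomainType) (a : R) (I : set R) : is_ideal I ->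
  (forall M, is_maximal_ideal M -> I `<=` M -> ~ M a) -> comaximal a I.
Proof.
move=> iI H; apply: contrapT => nc.
have [|M mM IM] := maximal_above (ideal_adjoin_ideal a iI).
  by move=> eT; apply: nc; have : ideal_adjoin I a 1 by rewrite eT.
apply: (H M mM); first by move=> x Ix; apply: IM; exact: sub_ideal_adjoin.
by apply: IM; exact: mem_ideal_adjoin.
Qed.

(** * Consequences of dimension one *)

Lemma prime_maximal (R : idomainType) (P : set R) :
  krull_dimension R 1 -> is_prime_ideal P -> nonzero P -> is_maximal_ideal P.
Proof.
move=> [_ dim1] pP [c Pc c0]; case: (pP) => iP nP _; split=> // J iJ PJ.
apply: contrapT => /not_orP[nJP nJT].
have [M mM JM] := maximal_above iJ nJT.
have pM := maximal_prime mM.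
suff : has_prime_chain R 2 by move/dim1.
exists (fun i : 'I_3 => if i == 0 :> nat then [set 0] else
                        if i == 1 :> nat then P else M); split.
  move=> [[|[|[|//]]] ?] //=; split; first split.
  - by [].
  - by move=> x y -> ->; rewrite addr0.
  - by move=> a x ->; rewrite mulr0.
  - move=> e0; have : [set (0 : R)] 1 by rewrite e0.
    by move=> /= /eqP; rewrite oner_eq0.
  - by move=> x y /eqP; rewrite mulf_eq0 => /orP[/eqP|/eqP]; [left | right].
have zP : [set 0] `<` P.
  split; first by move=> _ ->; case: iP.
  by move=> /(_ _ Pc) e; move: c0; rewrite e eqxx.
have PM : P `<` M.
  split; first exact: subset_trans PJ JM.
  by move=> MP; apply: nJP; apply/seteqP; split=> //; exact: subset_trans JM MP.
move=> [[|[|[|//]]] ?] [[|[|[|//]]] ?] //= _.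
by split; [apply: subset_trans zP.1 PM.1 | move=> /(subset_trans PM.1) /zP.2].
Qed.

Lemma maximal_nonzero (R : idomainType) (M : set R) :
  krull_dimension R 1 -> is_maximal_ideal M -> nonzero M.
Proof.
move=> [[P [pP ltP]] _] [iM nM Mm].
apply/(nonzeroP iM) => eM.
have [iP nP _] := pP ord_max.
have [|eP|//] := Mm _ iP.
  by rewrite eM => _ ->; case: iP.
have [_] := ltP ord0 ord_max isT; apply.
by rewrite eP eM => _ ->; case: (pP ord0) => -[].
Qed.

(** Modulo the nonzero n every prime ideal is maximal. The elements a^k (1 - t a)
    form a multiplicative set; a prime containing n and avoiding this set would be
    maximal and miss a, and then it would contain some 1 - t a. *)
Lemma exp_split (R : idomainType) (n a : R) : krull_dimension R 1 -> n != 0 ->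
  exists k t q, a ^+ k * (1 - t * a) = q * n.
Proof.
move=> dim1 n0; apply: contrapT => H.
pose T := [set x | exists k t, x = a ^+ k * (1 - t * a)].
have iN : is_ideal [set x | exists q, x = q * n].
  split; first by exists 0; rewrite mul0r.
  - by move=> _ _ [q ->] [r ->]; exists (q + r); rewrite mulrDl.
  - by move=> b _ [q ->]; exists (b * q); rewrite mulrA.
have [|||P [pP NP PT _]] := @prime_avoiding R T _ _ _ iN.
- by exists 0, 0; rewrite mul0r subr0 mulr1.
- move=> _ _ [k [t ->]] [l [s ->]]; exists (k + l)%N, (t + s - t * s * a).
  by rewrite exprD; ring.
- by move=> _ [q ->] [k [t e]]; apply: H; exists k, t, q.
have Pn : P n by apply: NP; exists 1; rewrite mul1r.
have mP : is_maximal_ideal P by apply: prime_maximal => //; exists n.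
have nPa : ~ P a.
  by move=> Pa; apply: (PT a) => //; exists 1, 0; rewrite mul0r subr0 mulr1.
have /(maximal_comaximal _ mP) [t Pt] := nPa.
by apply: (PT _ Pt); exists 0, t; rewrite mul1r.
Qed.

(** * Localization inside the ring *)

(** For a maximal ideal M this is the contraction to R of n R_M. In general it is the
    contraction from the ring where the elements outside all maximal ideals over I
    are inverted. *)
Definition local_ideal (R : idomainType) (I : set R) (n : R) : set R :=
  [set r | exists s t, comaximal s I /\ s * r = t * n].

Lemma local_ideal_ideal (R : idomainType) (I : set R) n :
  is_ideal I -> is_ideal (local_ideal I n).
Proof.
move=> iI; split.
- exists 1, 0; rewrite mul0r mulr0; split=> //.
  by exists 1; rewrite mul1r subrr; case: iI.
- move=> x y [s [t [cs e]]] [s' [t' [cs' e']]]; exists (s * s'), (s' * t + s * t').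
  split; first exact: comaximalM.
  transitivity (s' * (s * x) + s * (s' * y)); first by ring.
  by rewrite e e'; ring.
- move=> a x [s [t [cs e]]]; exists s, (a * t); split=> //.
  by rewrite mulrCA e mulrA.
Qed.

Lemma local_ideal_gen (R : idomainType) (I : set R) n :
  is_ideal I -> local_ideal I n n.
Proof.
by case=> I0 _ _; exists 1, 1; split=> //; exists 1; rewrite mul1r subrr.
Qed.

Lemma local_idealS (R : idomainType) (I J : set R) m n :
  I `<=` J -> local_ideal I (m * n) `<=` local_ideal J n.
Proof.
move=> IJ r [s [t [cs e]]]; exists s, (t * m); split; last by rewrite e mulrA.
exact: comaximalS cs.
Qed.

(** The localized ideal has no maximal ideals above it but those above I: a power of
    the element 1 - r a of I is brought into (n) by an element congruent to 1
    modulo I. *)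
Lemma local_ideal_comaximal (R : idomainType) (I : set R) n a :
  krull_dimension R 1 -> is_ideal I -> n != 0 ->
  comaximal a I -> comaximal a (local_ideal I n).
Proof.
move=> dim1 iI n0 [r Ir].
have [k [t [q e]]] := exp_split (1 - r * a) dim1 n0.
have [r' e'] := exp_one_sub a r k.
exists r', (1 - t * (1 - r * a)), q; split; last by rewrite -e' mulrC.
by exists 1; rewrite mul1r opprB addrC subrK; case: iI => _ _; apply.
Qed.

Lemma local_ideal_sub (R : idomainType) (M : set R) n :
  is_maximal_ideal M -> M n -> local_ideal M n `<=` M.
Proof.
move=> mM Mn r [s [t [/(maximal_comaximal _ mM) ns e]]].
have [iM _ prM] := maximal_prime mM.
have /prM [//|//] : M (s * r) by rewrite e; case: iM => _ _; apply.
Qed.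

(** Since d is not in d M R_M, the ideal d m R_M is precise enough to tell apart two
    elements whose difference is d. This replaces high powers of M and the Krull
    intersection theorem. *)
Lemma local_ideal_proper (R : idomainType) (M : set R) d m :
  is_maximal_ideal M -> d != 0 -> M m -> ~ local_ideal M (d * m) d.
Proof.
move=> mM d0 Mm [s [t [/(maximal_comaximal _ mM) ns e]]]; apply: ns.
have -> : s = t * m by apply: (mulIf d0); rewrite e; ring.
by case: mM => -[_ _ MM] _ _; apply: MM.
Qed.

(** Finite generation gives a common denominator, which allows a condition on the
    localized ideal to be met by divisibility in the ring itself. *)
Lemma local_ideal_denominator (R : idomainType) (I : set R) n :
  noetherian R -> is_ideal I ->
  exists2 s, comaximal s I & forall r, local_ideal I n r -> exists t, s * r = t * n.
Proof.
move=> noeth iI; have iL := local_ideal_ideal n iI.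
have [l el] := noeth _ iL.
have : forall r, r \in l -> local_ideal I n r by move=> r rl; rewrite el => J [_]; apply.
suff gen : (forall r, r \in l -> local_ideal I n r) ->
    exists2 s, comaximal s I & forall r, r \in l -> exists t, s * r = t * n.
  move=> /gen [s cs sl]; exists s => // r.
  rewrite el => /(_ [set x | exists t, s * x = t * n]); apply; split; last first.
    by move=> x xl; exact: sl.
  split; first by exists 0; rewrite mul0r mulr0.
  - by move=> x y [t e] [t' e']; exists (t + t'); rewrite mulrDr e e' mulrDl.
  - by move=> a x [t e]; exists (a * t); rewrite mulrCA e mulrA.
elim: l {el} => [|a l IH] H.
  by exists 1 => //; exists 1; rewrite mul1r subrr; case: iI.
have [|s cs sl] := IH; first by move=> r rl; apply: H; rewrite inE rl orbT.
have [|s' [t' [cs' e']]] := H a; first by rewrite inE eqxx.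
exists (s * s'); first exact: comaximalM.
move=> r; rewrite inE => /orP[/eqP -> | /sl [t e]].
  by exists (s * t'); rewrite -mulrA e' mulrA.
by exists (s' * t); rewrite mulrAC e; ring.
Qed.

(** Removes from I the primary components at the maximal ideals containing a: with
    a^k (1 - t a) in I, the ideal I + (1 - t a) keeps exactly the others. *)
Lemma saturation_away (R : idomainType) (I : set R) a :
  krull_dimension R 1 -> is_ideal I -> nonzero I ->
  exists J, [/\ is_ideal J, I `<=` J, comaximal a J &
    forall M, is_maximal_ideal M -> I `<=` M -> ~ M a -> J `<=` M].
Proof.
move=> dim1 iI [c Ic c0]; have [k [t [q e]]] := exp_split a dim1 c0.
exists (ideal_adjoin I (1 - t * a)); split.
- exact: ideal_adjoin_ideal.
- exact: sub_ideal_adjoin.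
- by exists t; exact: mem_ideal_adjoin.
move=> M mM IM nMa; have [iM _ prM] := maximal_prime mM.
have M1 : M (1 - t * a).
  have : M (a ^+ k * (1 - t * a)).
    by rewrite e; apply: IM; case: iI => _ _; apply.
  elim: k {e} => [|k IH]; first by rewrite expr0 mul1r.
  by rewrite exprS -mulrA => /prM [].
move=> r [b /IM Mr]; case: iM => _ MD MM.
by have := MD _ _ Mr (MM b _ M1); rewrite subrK.
Qed.

(** * Neighborhoods and closures in the Golomb space *)

Lemma golomb_coset_nbhs (R : idomainType) (x : golomb R) (I : set R) :
  is_ideal I -> nonzero I -> comaximal (val x) I ->
  nbhs x (golomb_coset (val x) I).
Proof.
move=> iI /(nonzeroP iI) nzI cx; apply: open_nbhs_nbhs; split; last first.
  by exists 0; rewrite ?addr0 //; case: iI.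
exists [set golomb_coset (val x) I]; last by rewrite bigcup_set1.
move=> _ ->; apply: (finI_from1 _ (i := golomb_coset (val x) I)).
by exists (val x), I; split=> //; apply/ideal_span_comaximal.
Qed.

Lemma golomb_cosetI_sub (R : idomainType) (x : R) (I J : set R) :
  golomb_coset x (I `&` J) `<=` golomb_coset x I `&` golomb_coset x J.
Proof. by move=> u [i [Ii Ji] e]; split; exists i. Qed.

(** Cosets centered at x form a neighborhood base, since a coset containing x can be
    recentered and two cosets with center x meet in another one. *)
Lemma golomb_nbhsP (R : idomainType) (x : golomb R) (U : set (golomb R)) :
  nbhs x U -> exists I, [/\ is_ideal I, nonzero I, comaximal (val x) I &
    golomb_coset (val x) I `<=` U].
Proof.
rewrite nbhsE => -[B [[D' sD' eB] Bx] BU].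
move: Bx; rewrite -eB => -[A DA Ax].
have AU : A `<=` U by move=> y Ay; apply: BU; rewrite -eB; exists A.
have [F sF eA] := sD' _ DA.
suff fin : forall s : seq (set (golomb R)),
    (forall V, V \in s -> golomb_subbase V /\ V x) ->
    exists I, [/\ is_ideal I, nonzero I, comaximal (val x) I &
      forall V, V \in s -> golomb_coset (val x) I `<=` V].
  have [|I [iI nI cI IF]] := fin (enum_fset F).
    move=> V VF; split; first exact: set_mem (sF _ VF).
    by move: Ax; rewrite -eA; apply.
  by exists I; split=> // u Iu; apply: AU; rewrite -eA => V VF; exact: IF Iu.
elim=> [|V s IH] H.
  exists setT; split=> //; first by exists 1 => //; rewrite oner_neq0.
  by exists 0.
have [|I [iI nI cI Is]] := IH; first by move=> W Ws; apply: H; rewrite inE Ws orbT.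
have [|[a [J [iJ nJ sJ eV]]] Vx] := H V; first by rewrite inE eqxx.
move: Vx; rewrite eV => -[j Jj ex].
exists (I `&` J); split.
- exact: ideal_setI.
- by apply: nonzero_setI => //; apply/nonzeroP.
- apply: comaximal_setI => //; rewrite ex.
  by apply: comaximal_translate => //; apply/ideal_span_comaximal.
move=> W; rewrite inE => /orP[/eqP -> | Ws] u [i [Ii Ji] eu].
  exists (j + i); first by case: iJ => _ JD _; apply: JD.
  by rewrite eu ex addrA.
by apply: (Is _ Ws); exists i.
Qed.

Lemma closure_golomb_cosetP (R : idomainType) (u : golomb R) (a : R) (I : set R) :
  is_ideal I -> nonzero I ->
  closure (golomb_coset a I) u <->
  forall J, is_ideal J -> nonzero J -> comaximal (val u) J ->
    exists2 j, J j & I (val u - a + j).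
Proof.
move=> iI nI; split=> [cu J iJ nJ cJ | H U /golomb_nbhsP [J [iJ nJ cJ JU]]].
  have [v [[i Ii e] [j Jj e']]] := cu _ (golomb_coset_nbhs iJ nJ cJ).
  by exists j => //; rewrite addrAC -e' e addrAC subrr add0r.
have [j Jj Ij] := H J iJ nJ cJ.
have [c [Ic Jc] c0] := nonzero_setI iI iJ nI nJ.
(* The intersection of the cosets has at least two elements, so one is nonzero. *)
have [b [[Ib Jb] b0]] : exists b, (I `&` J) b /\ val u + j + b != 0.
  have [e|ne] := eqVneq (val u + j) 0.
    by exists c; rewrite e add0r.
  by exists 0; rewrite addr0; split=> //; split; [case: iI | case: iJ].
case: iI iJ => _ ID _ [_ JD _].
exists (exist _ (val u + j + b) b0); split.
  by exists (val u - a + j + b); [apply: ID | rewrite /=; ring].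
by apply: JU; exists (j + b); [apply: JD | rewrite /= addrA].
Qed.

(** If J is comaximal with u then it is comaximal with every divisor s of u, so s
    times u - a determines u - a modulo J. The case s = u shows that the elements
    of I belong to the closure of every coset of I. *)
Lemma closure_golomb_coset_multiple (R : idomainType) (u : golomb R) (a s t : R)
    (I : set R) : is_ideal I -> nonzero I -> val u = s * t ->
  I (s * (val u - a)) -> closure (golomb_coset a I) u.
Proof.
move=> iI nI e Is; apply/closure_golomb_cosetP => // J [_ _ JM] nJ [r Jr].
exists ((a - val u) * (1 - r * val u)); first exact: JM.
case: iI => _ _ /(_ (r * t) _ Is).
by congr (I _); rewrite e; ring.
Qed.

(** Here I and any J comaximal with u are comaximal: a maximal ideal over both would
    contain u. *)
Lemma closure_golomb_coset_radical (R : idomainType) (u : golomb R) (a : R)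
    (I : set R) : is_ideal I -> nonzero I ->
  (forall M, is_maximal_ideal M -> I `<=` M -> M (val u)) ->
  closure (golomb_coset a I) u.
Proof.
move=> iI nI H; apply/closure_golomb_cosetP => // J iJ nJ [r Jr].
have [b Ib] : comaximal (1 - r * val u) I.
  apply: comaximal_of_maximal => // M mM IM M1.
  apply: (maximal_not1 mM); case: (mM) => -[_ MD MM] _ _.
  by have := MD _ _ M1 (MM r _ (H M mM IM)); rewrite subrK.
exists ((a - val u) * (b * (1 - r * val u))).
  by rewrite mulrA; case: iJ => _ _; apply.
case: iI => _ _ /(_ (val u - a) _ Ib).
by congr (I _); ring.
Qed.

(** With d = y - z and c in I, take L to be d c localized at I, and let u be outside
    M. The localization Q of d c at M contains L and is comaximal with u, so the
    neighborhood u + Q meets both cosets, and y - z = d would belong to Q. *)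
Lemma separating_ideal (R : idomainType) (I : set R) (y z : golomb R) :
  krull_dimension R 1 -> is_ideal I -> nonzero I -> y <> z ->
  exists L, [/\ is_ideal L, nonzero L,
    forall a, comaximal a I -> comaximal a L &
    forall (u : golomb R) M, is_maximal_ideal M -> I `<=` M ->
      closure (golomb_coset (val y) L) u ->
      closure (golomb_coset (val z) L) u -> M (val u)].
Proof.
move=> dim1 iI [c Ic c0] yz; pose d := val y - val z.
have d0 : d != 0 by rewrite subr_eq0; apply/eqP => /val_inj.
have dc0 : d * c != 0 by rewrite mulf_neq0.
have iL := local_ideal_ideal (d * c) iI.
have nL : nonzero (local_ideal I (d * c)).
  by exists (d * c) => //; exact: local_ideal_gen.
exists (local_ideal I (d * c)); split=> //.
  by move=> a ca; exact: local_ideal_comaximal.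
move=> u M mM IM /(closure_golomb_cosetP _ _ iL nL) cy.
move=> /(closure_golomb_cosetP _ _ iL nL) cz; apply: contrapT => nMu.
have iM : is_ideal M by case: mM.
have iQ := local_ideal_ideal (d * c) iM.
have LQ : local_ideal I (d * c) `<=` local_ideal M (d * c).
  by rewrite -{1}[d * c]mul1r; exact: local_idealS.
have nQ : nonzero (local_ideal M (d * c)) by exists (d * c) => //; exact: local_ideal_gen.
have cQ : comaximal (val u) (local_ideal M (d * c)).
  by apply: local_ideal_comaximal => //; apply/maximal_comaximal.
have [j Qj /LQ Qy] := cy _ iQ nQ cQ.
have [k Qk /LQ Qz] := cz _ iQ nQ cQ.
apply: (local_ideal_proper mM d0 (IM _ Ic)).
have := ideal_sub iQ (ideal_sub iQ Qz Qk) (ideal_sub iQ Qy Qj).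
by congr (local_ideal _ _ _); rewrite /d; ring.
Qed.

(** * The inclusion of V(y) in V(x) in topological terms *)

(** A single auxiliary point z, quantified existentially, would have to be a unit
    when x is one, and the ring may have no unit other than x and y. The choice of w
    after z repairs this: V(z) and V(w) need only be disjoint outside V(x). With
    w = x the condition would hold for all x and y. *)
Definition dominates (T : topologicalType) (x y : T) : Prop :=
  forall z, z <> x -> z <> y -> exists2 w, w <> x &
    forall U, nbhs x U -> exists A B C, [/\ nbhs y A, nbhs z B, nbhs w C &
      closure A `&` closure B `&` closure C `<=` closure U].

(** For a maximal ideal containing z, the elements x + z^k and x belong to it
    simultaneously. If z itself does not serve as w, then z is not a unit, its powers
    are distinct, and one of the first three values of x + z^k is admissible. *)
Lemma exists_coprime_modulo (R : idomainType) (x y z : golomb R) :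
  z <> x -> z <> y -> exists w : golomb R, [/\ w <> x, w <> y &
    forall M, is_maximal_ideal M -> M (val z) -> M (val w) -> M (val x)].
Proof.
move=> zx zy.
have [H|] := pselect (forall M, is_maximal_ideal M -> M (val z) -> M (val x)).
  by exists z; split=> // M mM Mz _; exact: H.
move=> /existsNP [M0 /not_implyP [mM0 /not_implyP [M0z _]]].
have z0 : val z != 0 by exact: (valP z).
have zpow k : (val z ^+ k.+1 == 1) = false.
  apply/eqP => e; apply: (maximal_not1 mM0); rewrite -e exprSr.
  by case: mM0 => -[_ _ MM] _ _; apply: MM.
pose f k := val x + val z ^+ k.+1.
have f_inj : injective f.
  move=> k l; wlog kl : k l / (k <= l)%N.
    move=> H; have [/H //|/ltnW /H H' /esym /H' //] := leqP k l.
  rewrite -(subnKC kl); case: (l - k)%N => [|m]; first by rewrite addn0.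
  rewrite /f -addSn exprD => /addrI /esym.
  rewrite -[X in _ = X]mulr1 => /mulfI -/(_ (expf_neq0 _ z0)) /eqP.
  by rewrite zpow.
(* Three distinct candidates, two forbidden values. *)
have [k [k0 ky]] : exists k, f k != 0 /\ f k != val y.
  apply: contrapT => H.
  have : (size (map f (iota 0 3)) <= size [:: 0%R; val y])%N; last by [].
  apply: uniq_leq_size; first by rewrite (map_inj_uniq f_inj) iota_uniq.
  move=> _ /mapP [k _ ->]; rewrite !inE; apply: contrapT => /negP.
  by rewrite negb_or => /andP[k0 ky]; apply: H; exists k.
pose w : golomb R := exist _ (f k) k0; exists w; split.
- move=> /(congr1 val) /= /eqP; rewrite -subr_eq0 addrAC subrr add0r.
  by rewrite expf_eq0 (negbTE z0).
- by move=> /(congr1 val) /= /eqP; apply/negP.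
move=> M [[_ MD MM] _ _] Mz Mw.
have := MD _ _ (Mw : M (f k)) (MM (- val z ^+ k) _ Mz).
by congr (M _); rewrite /f exprSr; ring.
Qed.

(** At each M over I at least one of z and w is not in M, and [saturation_away]
    discards the places of I where the point in question cannot be used. *)
Lemma dominates_of_maxV_sub (R : idomainType) (x y : golomb R) :
  krull_dimension R 1 -> maxV y `<=` maxV x -> dominates x y.
Proof.
move=> dim1 Vyx z zx zy.
have [w [wx wy zwx]] := exists_coprime_modulo zx zy.
exists w => // U /golomb_nbhsP [I [iI nI cxI IU]].
have cyI : comaximal (val y) I.
  apply: comaximal_of_maximal => // M mM IM My.
  have [_ Mx] := Vyx M (conj mM My).
  by have /(maximal_comaximal _ mM) := comaximalS IM cxI; apply.
have sep v : v <> y -> exists L, [/\ is_ideal L, nonzero L,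
    comaximal (val y) L, comaximal (val v) L &
    forall (u : golomb R) M, is_maximal_ideal M -> I `<=` M -> ~ M (val v) ->
      closure (golomb_coset (val y) L) u ->
      closure (golomb_coset (val v) L) u -> M (val u)].
  move=> vy; have [J [iJ IJ cJ JM]] := saturation_away (val v) dim1 iI nI.
  have nJ : nonzero J by case: nI => c /IJ Jc c0; exists c.
  have [|L [iL nL cL HL]] := @separating_ideal R J y v dim1 iJ nJ.
    by move/esym.
  exists L; split=> //; [|exact: cL|].
    by apply: cL; exact: comaximalS cyI.
  by move=> u M mM IM nMv; apply: HL => //; exact: JM.
have [L1 [iL1 nL1 cy1 cz1 H1]] := sep z zy.
have [L2 [iL2 nL2 cy2 cw2 H2]] := sep w wy.
exists (golomb_coset (val y) (L1 `&` L2)), (golomb_coset (val z) L1),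
  (golomb_coset (val w) L2); split.
- apply: golomb_coset_nbhs; first exact: ideal_setI.
    exact: nonzero_setI.
  exact: comaximal_setI.
- exact: golomb_coset_nbhs.
- exact: golomb_coset_nbhs.
move=> u [[uy uz] uw].
have [uy1 uy2] : closure (golomb_coset (val y) L1) u /\
    closure (golomb_coset (val y) L2) u.
  by split; apply: closureS uy => v /golomb_cosetI_sub [].
apply: (closureS IU); apply: closure_golomb_coset_radical => // M mM IM.
have [Mz|nMz] := pselect (M (val z)); last exact: (H1 u M).
apply: (H2 u M) => // Mw.
have Mx := zwx M mM Mz Mw.
by have /(maximal_comaximal _ mM) := comaximalS IM cxI; apply.
Qed.

(** Suppose that M contains y but not x, and let z = y^2. The closed neighborhood of
    x to be escaped is given by Q, the localization at M of d p, where d is the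
    difference of v and x for the value v that u should approximate at M, and p is
    in M. The point u is congruent to v at M up to n = c d p, with c in the ideal of
    the neighborhood C of w, and is divisible by a, b, c' and s, none of which is in
    M: a and b put u in the ideals at y and z, and s clears the denominator of the
    congruence between u and w. *)
Lemma maxV_sub_of_dominates (R : idomainType) (x y : golomb R) :
  krull_dimension R 1 -> noetherian R -> dominates x y -> maxV y `<=` maxV x.
Proof.
move=> dim1 noeth dom M [mM My]; split=> //; apply: contrapT => nMx.
have [iM nM prM] := maximal_prime mM.
have [_ MD MM] := iM.
have y20 : val y ^+ 2 != 0 by rewrite expf_neq0 //; exact: (valP y).
pose z : golomb R := exist _ (val y ^+ 2) y20.
have Mz : M (val z) by rewrite /= expr2; exact: MM.
have [||w wx domw] := dom z.
- by move=> e; apply: nMx; rewrite -e.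
- move=> /(congr1 val) /=; rewrite expr2 -[in RHS](mul1r (val y)).
  move=> /(mulIf (valP y)) e.
  by apply: (maximal_not1 mM); rewrite -e.
have [p Mp p0] := maximal_nonzero dim1 mM.
(* The witness follows w at M when M does not contain w; otherwise C imposes
   nothing at M and any value outside M other than x will do. *)
have [v [nMv vx Mv]] : exists v, [/\ ~ M v, v != val x & ~ M (val w) -> v = val w].
  have [Mw|nMw] := pselect (M (val w)); last first.
    by exists (val w); split=> //; apply/eqP => /val_inj.
  exists (val x + p); split=> //; last first.
    by rewrite -subr_eq0 addrAC subrr add0r.
  by move=> Mxp; apply: nMx; have := ideal_sub iM Mxp Mp; rewrite addrK.
pose d := v - val x; have d0 : d != 0 by rewrite subr_eq0.
have dp0 : d * p != 0 by rewrite mulf_neq0.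
pose Q := local_ideal M (d * p).
have iQ : is_ideal Q by exact: local_ideal_ideal.
have nQ : nonzero Q by exists (d * p) => //; exact: local_ideal_gen.
have cQ a : ~ M a -> comaximal a Q.
  by move=> nMa; apply: local_ideal_comaximal => //; apply/maximal_comaximal.
have [A [B [C [/golomb_nbhsP [A' [iA nA cA AA]] /golomb_nbhsP [B' [iB nB cB BB]]
  /golomb_nbhsP [C' [iC nC cC CC]] ABC]]]] := domw _ (golomb_coset_nbhs iQ nQ (cQ _ nMx)).
have outside (K : set R) (k : golomb R) : comaximal (val k) K -> M (val k) ->
    exists2 a, K a & ~ M a.
  move=> cK Mk; apply: contrapT => H.
  have KM : K `<=` M by move=> a Ka; apply: contrapT => nMa; apply: H; exists a.
  by have /(maximal_comaximal _ mM) := comaximalS KM cK; apply.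
have [a Aa nMa] := outside _ _ cA My.
have [b Bb nMb] := outside _ _ cB Mz.
(* The factor c' = 1 leaves u free when the congruence with w is used instead. *)
have [c' nMc' Cc'] : exists2 c', ~ M c' & M (val w) -> C' c'.
  have [Mw|nMw] := pselect (M (val w)); last by exists 1 => //; exact: maximal_not1.
  by have [c' Cc' nMc'] := outside _ _ cC Mw; exists c'.
have [c Cc c0] := nC.
pose n := c * (d * p).
have n0 : n != 0 by rewrite mulf_neq0.
have Mn : M n by rewrite /n mulrA; exact: MM.
have [s cs sn] := local_ideal_denominator n noeth iM.
have nMs : ~ M s by apply/maximal_comaximal.
pose e := s * a * b * c'.
have nMe : ~ M e by do !case/prM => //.
have [r Nr] : comaximal e (local_ideal M n).
  by apply: local_ideal_comaximal => //; apply/maximal_comaximal.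
have iN := local_ideal_ideal n iM.
pose u := v * r * e.
have Nuv : local_ideal M n (u - v).
  case: iN => _ _ /(_ (- v) _ Nr).
  by congr (local_ideal _ _ _); rewrite /u; ring.
have nMu : ~ M u.
  move=> Mu; apply: nMv.
  have := ideal_sub iM Mu (local_ideal_sub mM Mn Nuv).
  by rewrite opprB addrC subrK.
have u0 : u != 0 by apply/eqP => e0; apply: nMu; rewrite e0; case: iM.
pose gu : golomb R := exist _ u u0.
have inI (I : set R) (g : golomb R) : is_ideal I -> nonzero I -> I u ->
    closure (golomb_coset (val g) I) gu.
  move=> iI nI Iu; apply: (@closure_golomb_coset_multiple _ _ _ u 1) => //.
    by rewrite mulr1.
  by rewrite mulrC; case: iI => _ _; apply.
have : closure (golomb_coset (val x) Q) gu.
  apply: ABC; split; [split|].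
  - apply: (closureS AA); apply: inI => //.
    case: iA => _ _ /(_ (v * r * s * b * c') _ Aa).
    by congr (A' _); rewrite /u /e; ring.
  - apply: (closureS BB); apply: inI => //.
    case: iB => _ _ /(_ (v * r * s * a * c') _ Bb).
    by congr (B' _); rewrite /u /e; ring.
  apply: (closureS CC); have [Mw|nMw] := pselect (M (val w)).
    apply: inI => //; case: iC => _ _ /(_ (v * r * s * a * b) _ (Cc' Mw)).
    by congr (C' _); rewrite /u /e; ring.
  have [t et] := sn _ Nuv.
  apply: (@closure_golomb_coset_multiple _ _ _ s (v * r * a * b * c')) => //.
    by rewrite /= /u /e; ring.
  have -> : s * (val gu - val w) = t * (d * p) * c.
    by rewrite -(Mv nMw) et /n; ring.
  by case: iC => _ _; apply.
move=> /(closure_golomb_cosetP _ _ iQ nQ) /(_ Q iQ nQ (cQ _ nMu)) [j Qj Qu].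
apply: (local_ideal_proper mM d0 Mp).
have Quv : Q (u - v) by apply: local_idealS Nuv.
have := ideal_sub iQ (ideal_sub iQ Qu Qj) Quv.
by congr (Q _); rewrite /d /=; ring.
Qed.

(** * Transport along homeomorphisms *)

Lemma closure_preimage_sub (T U : topologicalType) (f : T -> U) (A : set U) :
  continuous f -> closure (f @^-1` A) `<=` f @^-1` closure A.
Proof.
move=> cf x cx B nB; have [y [Ay By]] := cx _ (cf x B nB).
by exists (f y).
Qed.

Lemma homeomorphism_inverse (T U : topologicalType) (f : T -> U) :
  homeomorphism f -> exists g : U -> T,
    [/\ cancel f g, cancel g f & homeomorphism g].
Proof. by case=> g [fg gf cf cg]; exists g; split=> //; exists f. Qed.

Lemma homeomorphism_dominates (T U : topologicalType) (f : T -> U) (x y : T) :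
  homeomorphism f -> dominates x y -> dominates (f x) (f y).
Proof.
case=> g [fg gf cf cg] dom z zx zy.
have gne t : z <> f t -> g z <> t by move=> zt e; apply: zt; rewrite -e gf.
have [w wx H] := dom (g z) (gne _ zx) (gne _ zy).
exists (f w); first by move=> /(can_inj fg).
move=> V /(cf x) nV; have [A [B [C [nA nB nC ABC]]]] := H _ nV.
exists (g @^-1` A), (g @^-1` B), (g @^-1` C); split.
- by apply: cg; rewrite fg.
- exact: cg.
- by apply: cg; rewrite fg.
move=> q [[qA qB] qC]; rewrite -(gf q); apply: (closure_preimage_sub cf).
by apply: ABC; split; [split|]; apply: (closure_preimage_sub cg).
Qed.

Lemma image_golomb_filter_sub (R S : idomainType) (f : golomb R -> golomb S)
    (x : golomb R) (F : set (golomb R)) :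
  homeomorphism f -> f (golomb1 R) = golomb1 S ->
  golomb_filter x F -> golomb_filter (f x) (f @` F).
Proof.
case=> g [fg gf cf cg] f1 [A [B [nA nB AB]]].
exists (g @^-1` A), (g @^-1` B); split.
- by apply: cg; rewrite fg.
- by apply: cg; rewrite -f1 fg.
move=> q [qA qB]; exists (g q); last exact: gf.
by apply: AB; split; apply: (closure_preimage_sub cg).
Qed.

(** The inverse homeomorphism also preserves [dominates], so the comparison of the
    sets V goes both ways and gives well-definedness and injectivity at once. *)
Theorem proposition2p5 (R S : idomainType)
    (hR : dedekind_domain R) (hS : dedekind_domain S)
    (h : golomb R -> golomb S) (hh : homeomorphism h) :
  (h (golomb1 R) = golomb1 S ->
     forall x : golomb R,
       [set h @` F | F in golomb_filter x] = golomb_filter (h x)) /\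
  (exists hbar : set (set R) -> set (set S),
     (forall x : golomb R, hbar (maxV x) = maxV (h x)) /\
     inclusion_isomorphism (calV R) (calV S) hbar).
Proof.
have [g [hg gh gg]] := homeomorphism_inverse hh.
split=> [h1 x | ].
  have g1 : g (golomb1 S) = golomb1 R by rewrite -h1 hg.
  apply/seteqP; split=> [_ [F FF <-] | G GG]; first exact: image_golomb_filter_sub.
  exists (g @` G).
    by rewrite -[x]hg; exact: image_golomb_filter_sub.
  by rewrite image_comp (_ : h \o g = id) ?image_id //; apply/funext => q; exact: gh.
have [dimR noethR _] := hR; have [dimS noethS _] := hS.
have Vh x y : maxV y `<=` maxV x <-> maxV (h y) `<=` maxV (h x).
  split=> H.
    apply: maxV_sub_of_dominates => //; apply: homeomorphism_dominates => //.
    exact: dominates_of_maxV_sub.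
  rewrite -[x]hg -[y]hg; apply: maxV_sub_of_dominates => //.
  apply: homeomorphism_dominates => //; exact: dominates_of_maxV_sub.
have Veq x y : maxV x = maxV y <-> maxV (h x) = maxV (h y).
  by rewrite !eqEsubset; split=> -[/Vh ? /Vh ?].
pose hbar (X : set (set R)) := \bigcup_(x in [set x | maxV x = X]) maxV (h x).
have hbarE x : hbar (maxV x) = maxV (h x).
  apply/seteqP; split=> [N [x' /Veq -> //] | N Nx]; by exists x.
exists hbar; split=> //; split; last first.
  by move=> _ _ [x _ <-] [y _ <-]; rewrite !hbarE; exact: Vh.
split.
- by move=> _ [x _ <-]; rewrite hbarE; exists (h x).
- move=> _ _ /set_mem [x _ <-] /set_mem [y _ <-]; rewrite !hbarE.
  by move/Veq.
- by move=> _ [q _ <-]; exists (maxV (g q)); [exists (g q) | rewrite hbarE gh].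
Qed.
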